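(* Let $G$ be a finite simple undirected graph with $m$ edges. Suppose that $G$ contains neither $C_3$ nor $C_5$ as a subgraph and that $G$ is non-bipartite. Then $\lambda(G)\le \gamma(m)$. Moreover, equality holds if and only if $m$ is odd and $G$ is isomorphic, up to isolated vertices, to $S_3(K_{2,\frac{m-3}{2}})$.
   Context: All graphs are finite, simple and undirected. $C_k$ denotes the cycle on $k$ vertices, and $K_{s,t}$ denotes the complete bipartite graph with parts of sizes $s$ and $t$. ''Contains $F$ as a subgraph'' means as a not necessarily induced subgraph. $\lambda(G)$ denotes the spectral radius of $G$, i.e. the largest absolute value of an eigenvalue of the adjacency matrix of $G$ (equivalently its largest eigenvalue). For integers $a,b\ge 2$, $S_3(K_{a,b})$ denotes the graph obtained from $K_{a,b}$ by replacing one edge with a five-vertex path $P_5$, i.e. by subdividing that edge with three new vertices (so the edge becomes a path with $4$ edges); it has $ab+3$ edges. For each integer $m\ge 7$, $\gamma(m)$ denotes the largest real root of the polynomial $$L(x)=x^7-mx^5+(4m-14)x^3-(3m-14)x-m+5.$$ (A non-bipartite graph containing neither $C_3$ nor $C_5$ has an odd cycle of length at least $7$, so necessarily $m\ge 7$ and $\gamma(m)$ is defined.) Convention: for results about graphs with a given number of edges, possible isolated vertices are ignored. *)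

(* Defs.v *)
From mathcomp Require Import all_boot all_order all_algebra.
From mathcomp Require Import classical_sets reals.

Set Implicit Arguments.
Unset Strict Implicit.
Unset Printing Implicit Defensive.

Import Order.TTheory GRing.Theory Num.Theory.

Record sgraph := SGraph {
  vertex :> finType;
  adj : rel vertex;
  adj_sym : symmetric adj;
  adj_irrefl : irreflexive adj }.

Definition edge_set (G : sgraph) : {set {set G}} :=
  [set [set p.1; p.2] | p : G * G & adj p.1 p.2].

Definition bipartite (G : sgraph) : Prop :=
  exists c : G -> bool, forall x y : G, adj x y -> c x != c y.

(* [F] is a subgraph of [G], not necessarily induced. *)
Definition contains (G F : sgraph) : Prop :=
  exists f : F -> G, injective f /\ forall x y : F, adj x y -> adj (f x) (f y).

Definition iso (G H : sgraph) : Prop :=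
  exists f : G -> H, bijective f /\ forall x y : G, adj (f x) (f y) = adj x y.

Section InducedSubgraph.
Variables (G : sgraph) (P : pred G).
Definition induced_rel : rel {x : G | P x} := fun x y => adj (val x) (val y).
Lemma induced_sym : symmetric induced_rel.
Proof. by move=> x y; exact: adj_sym. Qed.
Lemma induced_irrefl : irreflexive induced_rel.
Proof. by move=> x; exact: adj_irrefl. Qed.
Definition induced : sgraph := SGraph induced_sym induced_irrefl.
End InducedSubgraph.

Definition remove_isolated (G : sgraph) : sgraph :=
  induced [pred x : G | [exists y : G, adj x y]].

Definition iso_up_to_isolated (G H : sgraph) : Prop :=
  iso (remove_isolated G) (remove_isolated H).

(* The cycle [C_k] when [3 <= k]; [ordS] is the successor modulo [k]. *)
Section CycleGraph.
Variable k : nat.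
Definition cycle_rel : rel 'I_k :=
  fun i j => (i != j) && ((j == ordS i) || (i == ordS j)).
Lemma cycle_rel_sym : symmetric cycle_rel.
Proof. by move=> i j; rewrite /cycle_rel eq_sym orbC. Qed.
Lemma cycle_rel_irrefl : irreflexive cycle_rel.
Proof. by move=> i; rewrite /cycle_rel eqxx. Qed.
Definition cycle_graph : sgraph := SGraph cycle_rel_sym cycle_rel_irrefl.
End CycleGraph.

Section CompleteBipartite.
Variables s t : nat.
Definition cb_rel : rel ('I_s + 'I_t) := fun x y =>
  match x, y with
  | inl _, inr _ | inr _, inl _ => true
  | _, _ => false
  end.
Lemma cb_rel_sym : symmetric cb_rel. Proof. by case=> i; case=> j. Qed.
Lemma cb_rel_irrefl : irreflexive cb_rel. Proof. by case. Qed.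
Definition complete_bipartite : sgraph := SGraph cb_rel_sym cb_rel_irrefl.
End CompleteBipartite.

(* For an edge [uv] of [G], the graph obtained by replacing [uv] with a path
   u - 0 - 1 - 2 - v through the three new vertices [inr 0], [inr 1], [inr 2]. *)
Section Subdivide3.
Variables (G : sgraph) (u v : G).
Definition sub3_half (x y : G + 'I_3) : bool :=
  match x, y with
  | inl a, inl b => adj a b && ([set a; b] != [set u; v])
  | inl a, inr k => ((a == u) && (k == 0 :> nat)) || ((a == v) && (k == 2 :> nat))
  | inr i, inr j => j == i.+1 :> nat
  | inr _, inl _ => false
  end.
Definition sub3_rel : rel (G + 'I_3) := fun x y => sub3_half x y || sub3_half y x.
Lemma sub3_rel_sym : symmetric sub3_rel.
Proof. by move=> x y; rewrite /sub3_rel orbC. Qed.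
Lemma sub3_rel_irrefl : irreflexive sub3_rel.
Proof.
by case=> [a|i]; rewrite /sub3_rel /= orbb; [rewrite adj_irrefl | rewrite ltn_eqF].
Qed.
Definition subdivide3 : sgraph := SGraph sub3_rel_sym sub3_rel_irrefl.
End Subdivide3.

Local Open Scope ring_scope.

Definition adjacency_matrix (R : realType) (G : sgraph) : 'M[R]_#|G| :=
  \matrix_(i, j) (adj (enum_val i) (enum_val j))%:R.

(* The adjacency matrix is real symmetric, so all its eigenvalues lie in [R];
   there are finitely many of them, and at least one if [G] has a vertex, in
   which case the supremum is a maximum. *)
Definition spectral_radius (R : realType) (G : sgraph) : R :=
  sup [set `|a| | a in [set a : R | eigenvalue (adjacency_matrix R G) a]]%classic.

Definition L (R : realType) (m : nat) : {poly R} :=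
  'X^7 - m%:R *: 'X^5 + (4 * m%:R - 14) *: 'X^3 - (3 * m%:R - 14) *: 'X
  - m%:R%:P + 5%:P.

(* A polynomial of odd degree has a real root, and only finitely many, so the
   supremum is a maximum. *)
Definition gamma (R : realType) (m : nat) : R :=
  sup [set x : R | root (L R m) x]%classic.

(* Main.v *)
Require Import Defs.
From mathcomp Require Import classical_sets reals.
From mathcomp Require Import all_boot all_order all_algebra.
From mathcomp Require polyrcf.
From mathcomp Require Import zify ring lra.

(** Let [l] be the absolute value of an eigenvalue of [G] and [K = l^2 - l - 1].
    The polynomial [L] is the product of [x^3 + x^2 - 2 x - 1], which is
    positive from 2 on, and of
    [quartic m x = (x^2 + 4 - m) (x^2 - x - 1) - 1].  Hence, for [l >= 2], the
    bound [l <= gamma m] follows from [quartic m l <= 0], that is, from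
    [m >= l^2 + 4 - 1 / K]; and values [l < 2] are harmless, because [G] has at
    least 7 edges, which gives [gamma m >= 2].

    Take the absolute values [x] of an eigenvector, scaled so that the largest
    one is [x u = 1]; then [l * x v] is at most the sum of [x] over the
    neighbours of [v].  Let [N] be the neighbourhood of [u] and [sigma >= l] the
    sum of [x] over [N].  As [N] is independent, counting the edges through [N]
    gives [l * sigma + deficits = m - #(edges missing N)], where the deficits are
    [1 - x w] for each edge from a vertex [w] to [N], plus the strictness of the
    inequalities on [N] ([mass_identity]).  If four edges miss [N], then
    [l^2 <= m - 4] and [quartic m l < 0].

    In the layering of [G] by the distance to [u], or to a chosen root in the
    other components, some edge [y1 y2] joins two vertices of the same level,
    since [G] is not bipartite.  Without closed walks of length 3 and 5, the two
    descending paths [y1 z1 g1] and [y2 z2 g2] are disjoint and start at level 3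
    or higher ([odd_level_edge]).  So at least
    three edges miss [N], and if there are exactly three, then they are [y1 y2],
    [y1 z1], [y2 z2], while [g1] and [g2] lie in [N].  In this configuration,
    called a [ladder], [z1] and [z2] have no common neighbour, and the
    inequalities at [z1], [z2], [y1], [y2] give
    [K * (x z1 + x z2) <= (l - 1) * sigma], while the deficits are at least
    [2 - (x z1 + x z2)].  Eliminating [x z1 + x z2] yields [quartic m l <= 0]
    ([quartic_cases]).

    If [quartic m l = 0], all these estimates are tight.  This forces, up to
    exchanging the two sides, [x z1 = 1], then [N] to consist of [g2] and of
    neighbours of [z1], and no further vertex to be adjacent to [N]
    ([ladder_extremal]).  So [G] is, up to isolated vertices, a 7-cycle with one
    vertex replaced by [k] independent copies, where [m = 2 k + 5]; and this is
    [S_3(K_{2,k+1})]: the vertices of the part of size 2 have [k] common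
    neighbours and are joined by one more path, of length 5.  Conversely, every
    root of the quartic that is at least 2 is an eigenvalue of this graph, with
    an explicit eigenvector ([blowup_eigenvalue]). *)

Set Implicit Arguments.
Unset Strict Implicit.
Unset Printing Implicit Defensive.

Import Order.TTheory GRing.Theory Num.Theory.

Local Open Scope ring_scope.

(** * Closed walks and layers *)

Lemma eq_set2 (T : finType) (a b c d : T) :
  ([set a; b] == [set c; d]) =
  (a == c) && (b == d) || (a == d) && (b == c).
Proof.
apply/eqP/idP => [eq_ab|]; last first.
  by case/orP=> /andP[/eqP-> /eqP->] //; rewrite setUC.
have : a \in [set c; d] by rewrite -eq_ab set21.
have : b \in [set c; d] by rewrite -eq_ab set22.
have : c \in [set a; b] by rewrite eq_ab set21.
have : d \in [set a; b] by rewrite eq_ab set22.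
by rewrite !inE; do 4![case/orP=> /eqP ?]; subst; rewrite ?eqxx ?orbT.
Qed.

Section Walks.
Variable G : sgraph.
Implicit Types (x y : G) (S : {set G}).

(** Forbidding closed walks instead of cycles saves checking that vertices are
    distinct. *)
Definition no_closed_3walk :=
  forall a b c : G, adj a b -> adj b c -> adj c a -> False.

Definition no_closed_5walk :=
  forall a b c d e : G,
    adj a b -> adj b c -> adj c d -> adj d e -> adj e a -> False.

Lemma C3_free_walk : ~ contains G (cycle_graph 3) -> no_closed_3walk.
Proof.
move=> noC3 a b c ab bc ca; apply: noC3.
have neq x y : adj x y -> x != y.
  by move=> xy; apply/eqP=> eq_xy; rewrite eq_xy adj_irrefl in xy.
have U : uniq [:: a; b; c].
  by rewrite /= !inE negb_or (neq _ _ ab) (neq _ _ bc) eq_sym (neq _ _ ca).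
exists (fun i : 'I_3 => nth a [:: a; b; c] i); split=> [i j /eqP|].
  by rewrite nth_uniq //= => /eqP/val_inj.
by case=> [[|[|[|?]]] ?] [[|[|[|?]]] ?] //=; rewrite /cycle_rel //= adj_sym.
Qed.

Lemma C5_free_walk :
  no_closed_3walk -> ~ contains G (cycle_graph 5) -> no_closed_5walk.
Proof.
move=> no3 noC5 a b c d e ab bc cd de ea; apply: noC5.
have neq x y : adj x y -> x != y.
  by move=> xy; apply/eqP=> eq_xy; rewrite eq_xy adj_irrefl in xy.
(* Two equal vertices at distance two on the walk would leave a closed walk of
   length three. *)
have skip v w x y z : adj v w -> adj w x -> adj x y -> adj y z -> adj z v -> v != x.
  move=> _ _ xy yz zv; apply/eqP=> eq_vx; rewrite -eq_vx in xy.
  exact: no3 xy yz zv.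
have U : uniq [:: a; b; c; d; e].
  rewrite /= !inE !negb_or (neq _ _ ab) (neq _ _ bc) (neq _ _ cd) (neq _ _ de).
  rewrite [a == e]eq_sym (neq _ _ ea) (skip _ _ _ _ _ ab bc cd de ea).
  rewrite (skip _ _ _ _ _ bc cd de ea ab) (skip _ _ _ _ _ cd de ea ab bc).
  rewrite [a == d]eq_sym (skip _ _ _ _ _ de ea ab bc cd).
  by rewrite [b == e]eq_sym (skip _ _ _ _ _ ea ab bc cd de).
exists (fun i : 'I_5 => nth a [:: a; b; c; d; e] i); split=> [i j /eqP|].
  by rewrite nth_uniq //= => /eqP/val_inj.
by case=> [[|[|[|[|[|?]]]]] ?] [[|[|[|[|[|?]]]]] ?] //=;
   rewrite /cycle_rel //= adj_sym.
Qed.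

Fixpoint walk n x y :=
  if n is n'.+1 then [exists z, walk n' x z && adj z y] else x == y.

Lemma connect_walk x y : connect (@adj G) x y -> exists n, walk n x y.
Proof.
case/connectP=> p; elim/last_ind: p y => [|p z IHp] y /=.
  by move=> _ ->; exists 0%N => /=.
rewrite rcons_path last_rcons => /andP[path_p pz] ->.
have [n walk_n] := IHp _ path_p erefl.
by exists n.+1 => /=; apply/existsP; exists (last x p); rewrite walk_n pz.
Qed.

(** [D] is the distance to a chosen root of the component, and [u] is the root
    of its own component.  Components other than that of [u] need a root too:
    they may contain all the odd cycles. *)
Lemma layering (u : G) : exists D : G -> nat,
  [/\ D u = 0%N,
      forall x y, adj x y -> (D x <= (D y).+1)%N,
      forall x n, D x = n.+1 -> exists2 y, adj x y & D y = n &
      forall x y, connect (@adj G) x y -> D x = 0%N -> D y = 0%N -> x = y].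
Proof.
have csym : connect_sym (@adj G) := sym_connect_sym (@adj_sym G).
pose r x := if connect (@adj G) u x then u else fingraph.root (@adj G) x.
have r_const x y : connect (@adj G) x y -> r x = r y.
  move=> xy; rewrite /r (same_connect_r csym xy).
  by case: ifP => // _; apply/(fingraph.rootP csym).
have r_connect x : exists n, walk n (r x) x.
  apply: connect_walk; rewrite /r; case: ifP => // _.
  by rewrite csym connect_root.
pose D x := ex_minn (r_connect x).
have D0 x : D x = 0%N -> r x = x.
  by rewrite /D; case: ex_minnP => n wn _ n0; rewrite n0 in wn; apply/eqP.
exists D; split.
- rewrite /D; case: ex_minnP => n _ /(_ 0%N) /=.
  by rewrite /r connect0 eqxx leqn0 => /(_ isT)/eqP.
- move=> x y xy; rewrite {2}/D; case: ex_minnP => n wn _.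
  rewrite /D; case: ex_minnP => k _; apply => /=.
  by apply/existsP; exists y; rewrite (r_const x y (connect1 xy)) wn adj_sym.
- move=> x n; rewrite {1}/D; case: ex_minnP => k wk mink ek; rewrite {}ek in wk mink.
  case/existsP: wk => y /andP[wy yx]; exists y; first by rewrite adj_sym.
  have ryx := r_const y x (connect1 yx).
  rewrite /D; case: ex_minnP => j wj minj.
  apply/eqP; rewrite eqn_leq minj ?ryx //= -ltnS; apply: mink => /=.
  by apply/existsP; exists y; rewrite -ryx wj.
- by move=> x y xy /D0 <- /D0 <-; exact: r_const.
Qed.

(** The parity of [D] is not a proper colouring, so some edge [y1 y2] has both
    ends on one level.  Going down from [y1] and from [y2], the two paths cannot
    meet one or two levels below, as this would close a walk of length 3 or 5;
    since a component has a single root, this also bounds the level from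
    below. *)
Lemma odd_level_edge u : no_closed_3walk -> no_closed_5walk -> ~ bipartite G ->
  exists (D : G -> nat) i (y1 y2 z1 z2 g1 g2 h1 h2 : G),
  [/\ D u = 0%N, forall x y, adj x y -> (D x <= (D y).+1)%N,
      [/\ adj y1 y2, adj y1 z1, adj y2 z2, adj z1 g1 & adj z2 g2],
      [/\ adj g1 h1, adj g2 h2, z1 != z2 & g1 != g2] &
      [/\ D y1 = i.+3, D z1 = i.+2, D g1 = i.+1 & D h1 = i] /\
      [/\ D y2 = i.+3, D z2 = i.+2, D g2 = i.+1 & D h2 = i]].
Proof.
move=> no3 no5 nbip; have [D [Du Dadj Ddown Droot]] := layering u.
have [y1 [y2 [y12 Dy]]] : exists y1 y2 : G, adj y1 y2 /\ D y1 = D y2.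
  have /existsP[y1 /existsP[y2 /andP[y12 /eqP D12]]] :
      [exists y1, exists y2, adj y1 y2 && (D y1 == D y2)].
    apply: (contra_notT _ nbip) => /existsPn none.
    exists (fun x => odd (D x)) => x y xy.
    have /existsPn/(_ y) := none x; rewrite xy /= => neqD.
    have := Dadj _ _ xy; have := Dadj y x; rewrite adj_sym xy => /(_ isT).
    move: neqD; case: (ltngtP (D x) (D y)) => // lt _ le1 le2.
      have e : D y = (D x).+1 by lia.
      by rewrite e /=; case: (odd (D x)).
    have e : D x = (D y).+1 by lia.
    by rewrite e /=; case: (odd (D y)).
  by exists y1, y2.
have root2 x y : connect (@adj G) x y -> D x = 0%N -> D y = 0%N -> x = y by exact: Droot.
have adjC x y : adj x y -> adj y x by rewrite adj_sym.
case D1: (D y1) => [|n]; have D2 := D1; rewrite Dy in D2.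
  by have e := root2 _ _ (connect1 y12) D1 D2; rewrite e adj_irrefl in y12.
have [z1 yz1 Dz1] := Ddown _ _ D1; have [z2 yz2 Dz2] := Ddown _ _ D2.
have z12 : z1 != z2.
  apply/eqP=> e; rewrite -e in yz2; exact: no3 y12 yz2 (adjC _ _ yz1).
have cz : connect (@adj G) z1 z2.
  apply: connect_trans (connect1 (adjC _ _ yz1)) _.
  exact: connect_trans (connect1 y12) (connect1 yz2).
case: n D1 D2 Dz1 Dz2 => [|n] D1 D2 Dz1 Dz2.
  by rewrite (root2 _ _ cz Dz1 Dz2) eqxx in z12.
have [g1 zg1 Dg1] := Ddown _ _ Dz1; have [g2 zg2 Dg2] := Ddown _ _ Dz2.
have g12 : g1 != g2.
  apply/eqP=> e; rewrite -e in zg2.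
  exact: no5 y12 yz2 zg2 (adjC _ _ zg1) (adjC _ _ yz1).
have cg : connect (@adj G) g1 g2.
  apply: connect_trans (connect1 (adjC _ _ zg1)) _.
  exact: connect_trans cz (connect1 zg2).
case: n D1 D2 Dz1 Dz2 Dg1 Dg2 => [|n] D1 D2 Dz1 Dz2 Dg1 Dg2.
  by rewrite (root2 _ _ cg Dg1 Dg2) eqxx in g12.
have [h1 gh1 Dh1] := Ddown _ _ Dg1; have [h2 gh2 Dh2] := Ddown _ _ Dg2.
by exists D, n, y1, y2, z1, z2, g1, g2, h1, h2.
Qed.

End Walks.

(** * Counting edges through an independent set *)

Lemma disjoint_set2 (T : finType) (x y : T) (S : {set T}) :
  [disjoint [set x; y] & S] = (x \notin S) && (y \notin S).
Proof. by rewrite disjoints_subset subUset !sub1set !inE. Qed.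

Section EdgeCounting.
Variable G : sgraph.
Implicit Types (x y : G) (S : {set G}).

Definition nbhd x : {set G} := [set y | adj x y].

Definition edges_off S : {set {set G}} :=
  [set e in edge_set G | [disjoint e & S]].

Lemma edge_setP (e : {set G}) :
  reflect (exists x y, adj x y /\ e = [set x; y]) (e \in edge_set G).
Proof.
apply: (iffP imsetP) => [[[x y] xy ->]|[x [y [xy ->]]]].
  by exists x, y; rewrite inE in xy.
by exists (x, y); rewrite ?inE.
Qed.

Lemma mem_edge x y : ([set x; y] \in edge_set G) = adj x y.
Proof.
apply/edge_setP/idP => [[a [b [ab /eqP]]]|xy]; last by exists x, y.
by rewrite eq_set2 => /orP[]/andP[/eqP-> /eqP->]; rewrite // adj_sym.
Qed.

Lemma mem_edges_off S x y :
  ([set x; y] \in edges_off S) = [&& adj x y, x \notin S & y \notin S].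
Proof. by rewrite inE mem_edge disjoint_set2. Qed.

(** An edge that meets an independent set has exactly one end in it. *)
Lemma card_edges_split S : {in S &, forall x y, ~~ adj x y} ->
  #|edge_set G| = (\sum_(v in S) #|nbhd v| + #|edges_off S|)%N.
Proof.
move=> indS; pose P := [set p : G * G | (p.1 \in S) && adj p.1 p.2].
have -> : (\sum_(v in S) #|nbhd v| = #|P|)%N.
  rewrite -[RHS]sum1_card.
  rewrite (eq_bigl (fun p => (p.1 \in S) && adj p.1 p.2)); last first.
    by move=> p; rewrite inE.
  rewrite -(pair_big_dep (mem S) (fun v w => adj v w) (fun _ _ => 1%N)) /=.
  by apply: eq_bigr => v _; rewrite -sum1_card; apply: eq_bigl => w; rewrite inE.
have inj : {in P &, injective (fun p : G * G => [set p.1; p.2])}.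
  move=> [a b] [c d]; rewrite !inE /= => /andP[aS ab] /andP[cS cd] /eqP.
  rewrite eq_set2 => /orP[/andP[/eqP-> /eqP->]//|/andP[/eqP e _]].
  by rewrite -e in cd; have := indS _ _ cS aS; rewrite cd.
rewrite -(card_in_imset inj).
rewrite -(cardsID [set e : {set G} | [disjoint e & S]] (edge_set G)) addnC.
congr (_ + _)%N; last by apply: eq_card => e; rewrite !inE.
apply: eq_card => e; rewrite !inE.
apply/andP/imsetP => [[ndis /edge_setP[x [y [xy e_xy]]]]|[[x y]]].
  subst e; move: ndis; rewrite disjoint_set2 negb_and !negbK.
  case/orP=> [xS|yS]; first by exists (x, y); rewrite ?inE /= ?xS.
  by exists (y, x); rewrite ?inE /= ?yS 1?adj_sym // setUC.
rewrite inE /= => /andP[xS xy] ->; rewrite mem_edge; split=> //.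
by rewrite disjoint_set2 xS.
Qed.

Lemma card_ge_uniq (T : finType) (A : {set T}) (s : seq T) :
  uniq s -> all [in A] s -> (size s <= #|A|)%N.
Proof.
by move=> us /allP sA; rewrite cardE uniq_leq_size // => z /sA; rewrite mem_enum.
Qed.

(** Seven edges show that [G] has at least 7 edges; sublists of them also serve
    to count the edges that miss a neighbourhood. *)
Lemma uniq_ladder_edges (D : G -> nat) i (y1 y2 z1 z2 g1 g2 h1 h2 : G) :
  [/\ y1 != y2, z1 != z2 & g1 != g2] ->
  [/\ D y1 = i.+3, D z1 = i.+2, D g1 = i.+1 & D h1 = i] ->
  [/\ D y2 = i.+3, D z2 = i.+2, D g2 = i.+1 & D h2 = i] ->
  uniq [:: [set y1; y2]; [set y1; z1]; [set y2; z2]; [set z1; g1];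
           [set z2; g2]; [set g1; h1]; [set g2; h2]].
Proof.
move=> [/negbTE y12 /negbTE z12 /negbTE g12] [D1 D2 D3 D4] [E1 E2 E3 E4].
have neqD a b : D a <> D b -> (a == b) = false.
  by move=> neqD; apply/eqP=> ab; rewrite ab in neqD.
rewrite /= !inE !eq_set2 y12 [y2 == y1]eq_sym y12 z12 [z2 == z1]eq_sym z12.
rewrite g12 [g2 == g1]eq_sym g12.
do ![match goal with |- context [?a == ?b] =>
  rewrite (neqD a b); last by (rewrite ?D1 ?D2 ?D3 ?D4 ?E1 ?E2 ?E3 ?E4; lia) end].
by rewrite ?andbF ?andFb.
Qed.

Lemma exchange_nbhd (R : nzRingType) S (F : G -> R) :
  \sum_(v in S) \sum_(w | adj v w) F w = \sum_w #|nbhd w :&: S|%:R * F w.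
Proof.
rewrite (exchange_big_dep xpredT) //=; apply: eq_bigr => w _.
rewrite sumr_const mulr_natl; congr (_ *+ _).
by apply: eq_card => v; rewrite !inE andbC adj_sym.
Qed.

End EdgeCounting.

(** * The inequality behind the bound *)

Section Arithmetic.
Variable R : realFieldType.

(** The factor of [L] that has [gamma] as a root when [m >= 7]; see [horner_L]. *)
Definition quartic (m : nat) (l : R) : R :=
  (l ^+ 2 + 4 - m%:R) * (l ^+ 2 - l - 1) - 1.

Lemma kappa_ge1 (l : R) : 2 <= l -> 1 <= l ^+ 2 - l - 1.
Proof.
move=> l2; have -> : l ^+ 2 - l - 1 = 1 + (l - 2) * (l + 1) by ring.
have : 0 <= (l - 2) * (l + 1) by apply: mulr_ge0; lra.
lra.
Qed.

(** The elimination for a ladder: [s] stands for [sigma], [d] for the total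
    deficit, [s1] and [s2] for the parts of [sigma] on the neighbours of [z1]
    and [z2], and [x1], [x2], [y1], [y2] for the values at [z1], [z2], [y1],
    [y2].  All hypotheses enter with positive coefficients, so equality makes
    each of them tight. *)
Lemma quartic_cases (m : nat) (l s d s1 s2 x1 x2 y1 y2 : R) :
  2 <= l -> l <= s -> l * s + d = m%:R - 3 ->
  2 - (x1 + x2) <= d -> s1 + s2 <= s ->
  l * x1 <= s1 + y1 -> l * x2 <= s2 + y2 ->
  l * y1 <= x1 + y2 -> l * y2 <= x2 + y1 ->
  quartic m l <= 0 /\
  (quartic m l = 0 ->
   [/\ s = l, d = 2 - (x1 + x2), s1 + s2 = s &
     [/\ l * x1 = s1 + y1, l * x2 = s2 + y2,
         l * y1 = x1 + y2 & l * y2 = x2 + y1]]).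
Proof.
move=> l2 ls dE dge s12 e1 e2 f1 f2; pose k := l ^+ 2 - l - 1.
have k1 : 1 <= k := kappa_ge1 l2.
have k2 : 1 <= k * l - l + 1.
  have -> : k * l - l + 1 = 1 + l * (l - 2) * (l + 1) by rewrite /k; ring.
  have : 0 <= l * (l - 2) * (l + 1) by rewrite !mulr_ge0 //; lra.
  lra.
have mE : m%:R = l * s + d + 3 by lra.
(* Eliminating the sums [x1 + x2] and [y1 + y2] fixes the coefficients. *)
have qE : - quartic m l = (s - l) * (k * l - l + 1) + k * (d - (2 - (x1 + x2)))
    + (l - 1) * ((s - (s1 + s2)) + (s1 + y1 - l * x1) + (s2 + y2 - l * x2))
    + ((x1 + y2 - l * y1) + (x2 + y1 - l * y2)).
  by rewrite /quartic mE /k; ring.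
have ge_term (a b : R) : 1 <= a -> 0 <= b -> b <= a * b.
  by move=> a1 b0; rewrite ler_peMl.
have t1 : s - l <= (s - l) * (k * l - l + 1) by rewrite mulrC ge_term ?subr_ge0.
have t2 : d - (2 - (x1 + x2)) <= k * (d - (2 - (x1 + x2))).
  by rewrite ge_term ?subr_ge0.
have t3 : (s - (s1 + s2)) + (s1 + y1 - l * x1) + (s2 + y2 - l * x2) <=
    (l - 1) * ((s - (s1 + s2)) + (s1 + y1 - l * x1) + (s2 + y2 - l * x2)).
  by rewrite ge_term; lra.
split; first by lra.
by move=> q0; rewrite q0 in qE; split; [lra|lra|lra|split; lra].
Qed.

Lemma quartic_lt0 (m : nat) (l : R) :
  2 <= l -> l ^+ 2 <= m%:R - 4 -> quartic m l < 0.
Proof.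
move=> l2 lm; rewrite /quartic.
have : (l ^+ 2 + 4 - m%:R) * (l ^+ 2 - l - 1) <= 0.
  by apply: mulr_le0_ge0; [lra|have := kappa_ge1 l2; lra].
lra.
Qed.

End Arithmetic.

(** * Blow-ups of the 7-cycle *)

Section Blowup.

(** The cyclic order on the labels 0, ..., 6 of a 7-cycle; 7 and above label
    isolated vertices. *)
Definition succ7 (i j : nat) := ((i < 7) && (j == i.+1 %% 7))%N.

(** A 7-cycle with one vertex (label 6) replaced by [k] independent copies, plus
    isolated vertices (label 7).  Up to isolated vertices this is
    [S_3(K_{2,k+1})], see [subdivide3_blowup]; in this form adjacency and
    neighbour sums depend on labels only. *)
Definition C7_blowup (G : sgraph) (k : nat) := exists lab : G -> nat,
  [/\ forall x, (lab x < 8)%N,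
      forall i, (i < 6)%N -> #|[set x | lab x == i]| = 1%N,
      #|[set x | lab x == 6]| = k &
      forall x y, adj x y = succ7 (lab x) (lab y) || succ7 (lab y) (lab x)].

(** Oriented edges of a path [s] on six vertices whose ends are both joined to
    all of [C]. *)
Definition blowup_step (G : sgraph) (x0 : G) (s : seq G) (C : {set G}) (x y : G) :=
  [\/ exists2 i, (i < 5)%N & x = nth x0 s i /\ y = nth x0 s i.+1,
      x = nth x0 s 5 /\ y \in C | x \in C /\ y = nth x0 s 0].

Lemma C7_blowup_intro (G : sgraph) (x0 : G) (s : seq G) (C : {set G}) :
  size s = 6 -> uniq s -> {in C, forall c, c \notin s} ->
  (forall x y, blowup_step x0 s C x y -> adj x y) ->
  (forall x y, adj x y -> blowup_step x0 s C x y \/ blowup_step x0 s C y x) ->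
  C7_blowup G #|C|.
Proof.
move=> sz us Cs stepP adjP.
pose lab x := if x \in s then index x s else if x \in C then 6 else 7.
have lab_nth i : (i < 6)%N -> lab (nth x0 s i) = i.
  by move=> i6; rewrite /lab mem_nth ?sz // index_uniq ?sz.
have labC x : x \in C -> lab x = 6 by move=> xC; rewrite /lab (negbTE (Cs _ xC)) xC.
have lab_lt6 x i : lab x = i -> (i < 6)%N -> x = nth x0 s i.
  rewrite /lab; case: ifP => [xs <- _|_]; first by rewrite nth_index.
  by case: ifP => _ <-.
have lab6 x : lab x = 6 -> x \in C.
  rewrite /lab; case: ifP => [xs e|_]; last by case: ifP.
  by have := index_mem x s; rewrite xs e sz.
have step_succ7 x y : blowup_step x0 s C x y <-> succ7 (lab x) (lab y).
  split.
    case=> [[i i5 [-> ->]]|[-> yC]|[xC ->]].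
    - rewrite !lab_nth ?(leq_trans i5) // /succ7 modn_small ?eqxx ?andbT; lia.
    - by rewrite (labC y) // lab_nth.
    - by rewrite (labC x) // lab_nth.
  case/andP=> lx /eqP ly.
  have [l5|l5|l5] := ltngtP (lab x) 5.
  - apply: Or31; exists (lab x) => //; split; apply: lab_lt6; rewrite ?ly //.
      by lia.
    by rewrite modn_small //; lia.
  - have l6 : lab x = 6 by apply/eqP; rewrite eqn_leq l5 -ltnS lx.
    by apply: Or33; split; [exact: lab6|apply: lab_lt6; rewrite ?ly ?l6].
  - apply: Or32; split; first exact: lab_lt6.
    by apply: lab6; rewrite ly l5.
exists lab; split.
- move=> x; rewrite /lab; case: ifP => [xs|_]; last by case: ifP.
  by apply: (@ltn_trans 6) => //; rewrite -[X in (_ < X)%N]sz index_mem.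
- move=> i i6; apply/eqP/cards1P; exists (nth x0 s i).
  apply/setP=> x; rewrite !inE; apply/eqP/eqP => [/lab_lt6->//|->].
  exact: lab_nth.
- apply: eq_card => x; rewrite inE; apply/eqP/idP; [exact: lab6|exact: labC].
- move=> x y; apply/idP/orP => [/adjP[]/step_succ7|]; [by left|by right|].
  by case=> /step_succ7/stepP //; rewrite adj_sym.
Qed.

End Blowup.

(** * Subharmonic functions on a graph without short odd cycles *)

Section Subharmonic.
Variables (R : realFieldType) (G : sgraph) (x : G -> R) (l : R) (u : G).
Hypotheses (no3 : no_closed_3walk G) (no5 : no_closed_5walk G).
Hypotheses (x_ge0 : forall v, 0 <= x v) (x_le1 : forall v, x v <= 1).
Hypotheses (xu : x u = 1) (l_ge2 : 2 <= l).
Hypothesis sub : forall v, l * x v <= \sum_(w | adj v w) x w.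

Local Notation N := (nbhd u).
Local Notation nsum v := (\sum_(w | adj v w) x w).
Local Notation sigma := (\sum_(v in N) x v).
Local Notation codeg w := #|nbhd w :&: N|.
Local Notation m := #|edge_set G|.

Let adjC (a b : G) : adj a b -> adj b a. Proof. by rewrite adj_sym. Qed.

Let adj_neq (a b : G) : adj a b -> a != b.
Proof. by move=> ab; apply/eqP=> e; rewrite e adj_irrefl in ab. Qed.

Lemma nbhd_indep : {in N &, forall a b, ~~ adj a b}.
Proof.
move=> a b; rewrite !inE => ua ub; apply/negP=> ab.
exact: no3 ua ab (adjC ub).
Qed.

(** Summing [l * x v <= nsum v] over [N] and exchanging the sums weights each
    [x w] by the number [codeg w] of edges from [w] to [N].  The identity keeps
    both kinds of loss, [x w < 1] and strict subharmonicity on [N], so that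
    equality cases can be read off. *)
Lemma mass_identity :
  l * sigma + (\sum_w (codeg w)%:R * (1 - x w) + \sum_(v in N) (nsum v - l * x v))
  = m%:R - #|edges_off N|%:R.
Proof.
rewrite (card_edges_split nbhd_indep) natrD addrK.
have -> : (\sum_(v in N) #|nbhd v|)%:R = \sum_w (codeg w)%:R * 1 :> R.
  rewrite -(exchange_nbhd N (fun _ => 1)) natr_sum; apply: eq_bigr => v _.
  by rewrite -sum1_card natr_sum; apply: eq_bigl => w; rewrite inE.
rewrite sumrB exchange_nbhd -mulr_sumr.
under [X in _ + (X + _)]eq_bigr do rewrite mulrBr.
rewrite sumrB; ring.
Qed.

Lemma sigma_ge : l <= sigma.
Proof.
have := sub u; rewrite xu mulr1 => /le_trans; apply.
by rewrite le_eqVlt; apply/orP; left; apply/eqP/eq_bigl => v; rewrite inE.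
Qed.

Lemma nsum_ge v (A : {set G}) : A \subset nbhd v -> \sum_(w in A) x w <= nsum v.
Proof.
move=> /subsetP Av.
rewrite [X in _ <= X](bigID (mem A)) /= -[X in X <= _]addr0 lerD ?sumr_ge0 //.
rewrite le_eqVlt; apply/orP; left; apply/eqP/eq_bigl => w.
by apply/idP/andP => [wA|[]//]; have := Av _ wA; rewrite inE.
Qed.

(** The configuration that remains when only three edges miss [N]; then the
    odd cycle closes up as [u g1 z1 y1 y2 z2 g2]. *)
Definition ladder y1 y2 z1 z2 g1 g2 :=
  [/\ adj y1 y2, adj y1 z1, adj y2 z2, adj z1 g1 & adj z2 g2] /\
  [/\ g1 \in N, g2 \in N &
      edges_off N = [set [set y1; y2]; [set y1; z1]; [set y2; z2]]].

Lemma ladder_sym y1 y2 z1 z2 g1 g2 :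
  ladder y1 y2 z1 z2 g1 g2 -> ladder y2 y1 z2 z1 g2 g1.
Proof.
case=> [[y12 yz1 yz2 zg1 zg2] [g1N g2N offE]]; split; first by split=> //; exact: adjC.
by split=> //; rewrite offE [ [set y1; y2]]setUC setUAC.
Qed.

Section Ladder.
Variables y1 y2 z1 z2 g1 g2 : G.
Hypothesis lad : ladder y1 y2 z1 z2 g1 g2.

(** A neighbour [v] in [N] would close the walk [y1 v u g1 z1]. *)
Lemma ladder_top_nbhd v : v \in N -> ~~ adj y1 v.
Proof.
case: lad => [[y12 yz1 yz2 zg1 zg2] [g1N g2N _]].
rewrite !inE in g1N g2N * => uv; apply/negP=> yv.
exact: no5 yv (adjC uv) g1N (adjC zg1) (adjC yz1).
Qed.

Lemma ladder_off a b : adj a b -> a \notin N -> b \notin N ->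
  [|| [set a; b] == [set y1; y2], [set a; b] == [set y1; z1] |
      [set a; b] == [set y2; z2]].
Proof.
case: lad => [_ [_ _ offE]] ab aN bN.
have : [set a; b] \in edges_off N by rewrite mem_edges_off ab aN bN.
by rewrite offE !inE orbA.
Qed.

Lemma ladder_notin : [/\ y1 \notin N, y2 \notin N, z1 \notin N & z2 \notin N].
Proof.
case: lad => [_ [_ _ offE]].
have : [set y1; z1] \in edges_off N by rewrite offE !inE eqxx !orbT.
have : [set y2; z2] \in edges_off N by rewrite offE !inE eqxx !orbT.
by rewrite !mem_edges_off => /and3P[_ -> ->] /and3P[_ -> ->].
Qed.

Lemma ladder_disjoint v : adj z1 v -> adj z2 v -> False.
Proof.
case: lad => [[y12 yz1 yz2 zg1 zg2] _] z1v z2v.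
exact: no5 y12 yz2 z2v (adjC z1v) (adjC yz1).
Qed.

Lemma ladder_neq : [/\ y1 != y2, z1 != z2, y1 != z2 & y2 != z1].
Proof.
case: lad => [[y12 yz1 yz2 zg1 zg2] [g1N g2N _]].
split; first exact: adj_neq.
- by apply/eqP=> e; apply: (@ladder_disjoint g1); rewrite -?e.
- by apply: contraTneq zg2 => <-; exact: ladder_top_nbhd.
- apply: contraTneq zg1 => <-; apply/negP=> yg.
  rewrite !inE in g1N g2N.
  exact: no5 yg (adjC g1N) g2N (adjC zg2) (adjC yz2).
Qed.

Lemma ladder_top_adj w : adj y1 w = (w == z1) || (w == y2).
Proof.
case: lad => [[y12 yz1 yz2 zg1 zg2] _].
have [n12 _ n3 n4] := ladder_neq; have [yN _ _ _] := ladder_notin.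
apply/idP/orP => [yw|[]/eqP-> //].
have wN : w \notin N by apply: contraTN yw; exact: ladder_top_nbhd.
have := ladder_off yw yN wN; rewrite !eq_set2 eqxx (negbTE n12) (negbTE n3) /=.
rewrite (negbTE (adj_neq yz1)) /= !orbF => /orP[]->; [by right|by left].
Qed.

Lemma ladder_mid_adj w : adj z1 w && (w \notin N) = (w == y1).
Proof.
case: lad => [[y12 yz1 yz2 zg1 zg2] _].
have [n12 n2 n3 n4] := ladder_neq; have [yN _ zN _] := ladder_notin.
apply/andP/eqP => [[zw wN]|->]; last by rewrite adj_sym yz1.
have := ladder_off zw zN wN; rewrite !eq_set2 [z1 == y2]eq_sym (negbTE n4).
rewrite [z1 == y1]eq_sym (negbTE (adj_neq yz1)) (negbTE n2) eqxx /=.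
by rewrite ?andbF ?orbF ?orFb => /eqP.
Qed.

Lemma ladder_nsum_top : nsum y1 = x z1 + x y2.
Proof.
have [_ _ _ n4] := ladder_neq.
rewrite (eq_bigl (fun w => w \in [set z1; y2])); last first.
  by move=> w; rewrite ladder_top_adj !inE.
by rewrite big_setU1 ?big_set1 // inE eq_sym.
Qed.

Lemma ladder_nsum_mid : nsum z1 = \sum_(v in nbhd z1 :&: N) x v + x y1.
Proof.
rewrite (bigID (mem N)) /=; congr (_ + _).
  by apply: eq_bigl => v; rewrite !inE.
by rewrite (eq_bigl (pred1 y1)) ?big_pred1_eq // => w; exact: ladder_mid_adj.
Qed.

Lemma ladder_sub : [/\ l * x z1 <= \sum_(v in nbhd z1 :&: N) x v + x y1,
  l * x y1 <= x z1 + x y2 & (0 < codeg z1)%N].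
Proof.
rewrite -ladder_nsum_mid -ladder_nsum_top; split=> //.
case: lad => [[y12 yz1 yz2 zg1 zg2] [g1N _ _]].
by apply/card_gt0P; exists g1; rewrite inE g1N inE zg1.
Qed.

Lemma ladder_off_card : #|edges_off N| = 3.
Proof.
case: lad => [[y12 yz1 yz2 zg1 zg2] [_ _ ->]].
have [/negbTE n1 /negbTE n2 /negbTE n3 /negbTE n4] := ladder_neq.
rewrite setUC cardsU1 cards2 !inE !eq_set2.
rewrite [y2 == y1]eq_sym [z2 == y1]eq_sym [z2 == z1]eq_sym eqxx n1 n2 n3 n4 /=.
by rewrite !andbF.
Qed.

End Ladder.

(** Beyond the tight inequalities, equality says that a vertex [w] with a
    neighbour in [N] has [x w = 1], except that one of the edges from [z1] to
    [N], and one of those from [z2], is already paid for by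
    [2 - (x z1 + x z2)]. *)
Lemma ladder_quartic y1 y2 z1 z2 g1 g2 : ladder y1 y2 z1 z2 g1 g2 ->
  quartic m l <= 0 /\
  (quartic m l = 0 -> let s w := \sum_(v in nbhd w :&: N) x v in
   [/\ sigma = l, s z1 + s z2 = l,
     [/\ l * x z1 = s z1 + x y1, l * x z2 = s z2 + x y2,
         l * x y1 = x z1 + x y2 & l * x y2 = x z2 + x y1],
     [/\ x z1 = 1 \/ codeg z1 = 1%N, x z2 = 1 \/ codeg z2 = 1%N &
         forall w, w != z1 -> w != z2 -> x w = 1 \/ codeg w = 0%N] &
     forall v, v \in N -> nsum v = l * x v]).
Proof.
move=> lad; have lad' := ladder_sym lad.
have [sub_z1 sub_y1 d1] := ladder_sub lad.
have [sub_z2 sub_y2 d2] := ladder_sub lad'.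
have [_ z12 _ _] := ladder_neq lad.
have massE := mass_identity; rewrite (ladder_off_card lad) in massE.
set d := (X in _ + X = _) in massE.
pose slack := \sum_(v in N) (nsum v - l * x v).
pose rest := \sum_(w | (w != z1) && (w != z2)) (codeg w)%:R * (1 - x w).
have term_ge0 w : 0 <= (codeg w)%:R * (1 - x w) by rewrite mulr_ge0 ?subr_ge0.
have slack_ge0 : 0 <= slack by apply: sumr_ge0 => v _; rewrite subr_ge0.
have rest_ge0 : 0 <= rest by apply: sumr_ge0.
have first_term w : (0 < codeg w)%N -> 0 <= ((codeg w)%:R - 1) * (1 - x w).
  by move=> dw; rewrite mulr_ge0 ?subr_ge0 // ler1n.
have dE : d = 2 - (x z1 + x z2) + ((codeg z1)%:R - 1) * (1 - x z1)
    + ((codeg z2)%:R - 1) * (1 - x z2) + rest + slack.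
  rewrite /d (bigD1 z1) //= (bigD1 z2) /=; last by rewrite eq_sym.
  by rewrite -/rest -/slack; ring.
have t1 := first_term _ d1; have t2 := first_term _ d2.
have s12 : \sum_(v in nbhd z1 :&: N) x v + \sum_(v in nbhd z2 :&: N) x v <= sigma.
  have dis : [disjoint nbhd z1 :&: N & nbhd z2 :&: N].
    rewrite -setI_eq0; apply/eqP/setP=> v; rewrite !inE.
    apply/negP=> /andP[/andP[z1v _] /andP[z2v _]].
    exact: (ladder_disjoint lad z1v z2v).
  rewrite -bigU //=.
  rewrite [X in _ <= X](bigID [predU nbhd z1 :&: N & nbhd z2 :&: N]) /=.
  rewrite -[X in X <= _]addr0 lerD ?sumr_ge0 //.
  rewrite le_eqVlt; apply/orP; left; apply/eqP/eq_bigl => v.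
  by rewrite !inE; case: (adj u v); rewrite ?andbF.
have dge : 2 - (x z1 + x z2) <= d by lra.
have [q_le0 q_eq0] := quartic_cases l_ge2 sigma_ge massE dge s12 sub_z1 sub_z2 sub_y1 sub_y2.
split=> // /q_eq0[sl dX s12E [e1 e2 e3 e4]] s.
have codeg1 w : (0 < codeg w)%N -> ((codeg w)%:R - 1) * (1 - x w) = 0 ->
    x w = 1 \/ codeg w = 1%N.
  move=> _ /eqP; rewrite mulf_eq0 !subr_eq0 => /orP[|/eqP]; last by left.
  by rewrite pnatr_eq1 => /eqP; right.
split=> //; first by rewrite s12E.
  split; [by apply: codeg1 => //; lra|by apply: codeg1 => //; lra|].
  move=> w w1 w2; have rest0 : rest = 0 by lra.
  have /eqP : (codeg w)%:R * (1 - x w) = 0.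
    by apply: (psumr_eq0P _ rest0) => //; rewrite w1 w2.
  rewrite mulf_eq0 subr_eq0 pnatr_eq0.
  by case/orP=> /eqP; [right|left].
have slack0 : slack = 0 by lra.
move=> v vN; apply/eqP; rewrite -subr_eq0; apply/eqP; move: v vN.
by apply: (psumr_eq0P _ slack0) => v _; rewrite subr_ge0.
Qed.

(** If [x z1 = 1], then [l * sigma_2 = 1 + x y2 <= 2], where [sigma_2] is the
    sum of [x] over the neighbours of [z2] in [N].  Each such neighbour [v] has
    [l * x v >= 1 + x z2 > 1], so there is only one.  A further vertex [w] with
    neighbours in [N] would have [x w = 1] and hence all of [N] as
    neighbourhood, in particular [g2], giving [l * x g2 >= 2 + x z2 > 2]. *)
Lemma ladder_extremal y1 y2 z1 z2 g1 g2 : ladder y1 y2 z1 z2 g1 g2 ->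
  quartic m l = 0 -> x z1 = 1 ->
  exists k, m = (2 * k + 5)%N /\ C7_blowup G k.
Proof.
move=> lad q0 xz1; have lad' := ladder_sym lad.
have [_ /(_ q0)[sl s12 [e1 e2 e3 e4] [_ _ other] tight]] := ladder_quartic lad.
have [[y12 yz1 yz2 zg1 zg2] [g1N g2N offE]] := lad.
have [n12 z12 yz12 yz21] := ladder_neq lad.
have [y1N y2N z1N z2N] := ladder_notin lad.
have l_gt0 : 0 < l by apply: lt_le_trans l_ge2; rewrite ltr0n.
have uN v : v \in N -> adj u v by rewrite inE.
have N_pos v : v \in N -> 0 < x v.
  move=> vN; rewrite -(pmulr_rgt0 _ l_gt0) -tight //.
  apply: lt_le_trans (nsum_ge (A := [set u]) _); first by rewrite big_set1 xu.
  by rewrite sub1set inE adj_sym uN.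
rewrite /= in s12 e1 e2.
set N1 := nbhd z1 :&: N in s12 e1; set N2 := nbhd z2 :&: N in s12 e2.
have g2N2 : g2 \in N2 by rewrite inE g2N inE zg2.
have xz2 : 0 < x z2.
  rewrite -(pmulr_rgt0 _ l_gt0) e2 ltr_wpDr // (bigD1 g2) //=.
  by rewrite ltr_wpDr ?sumr_ge0 // N_pos.
(* [sigma = l * x z1] leaves [x y1] as the sum over the neighbours of [z2]. *)
have s2 : l * \sum_(v in N2) x v = 1 + x y2.
  have -> : \sum_(v in N2) x v = x y1 by rewrite xz1 in e1; lra.
  by rewrite e3 xz1.
have uz2 : u != z2.
  by apply: contraNneq y2N => e; rewrite inE e adj_sym.
have uz1 : u != z1.
  by apply: contraNneq y1N => e; rewrite inE e adj_sym.
have N2_adj v : v \in N2 -> [/\ adj v u, adj v z2 & v \in N].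
  by rewrite !inE => /andP[zv uv]; rewrite adj_sym uv adj_sym zv.
have N2_ge v : v \in N2 -> 1 + x z2 <= l * x v.
  move=> /N2_adj[vu vz vN]; rewrite -tight //.
  apply: le_trans (nsum_ge (A := [set u; z2]) _).
    by rewrite big_setU1 ?inE // big_set1 xu.
  by apply/subsetP=> w; rewrite !inE => /orP[]/eqP->.
have N2E : N2 = [set g2].
  apply/esym/eqP; rewrite eqEcard sub1set g2N2 cards1 -ltnS /=.
  rewrite -(ltr_nat R).
  have : \sum_(v in N2) (1 + x z2) <= l * \sum_(v in N2) x v.
    by rewrite mulr_sumr ler_sum // => v /N2_ge.
  rewrite sumr_const -mulr_natr s2 => le_d.
  rewrite ltNge; apply/negP=> ge_d; have := x_le1 y2.
  have : (1 + x z2) * 2 <= (1 + x z2) * #|N2|%:R by rewrite ler_wpM2l //; lra.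
  lra.
have x_g2 : l * x g2 = 1 + x y2 by rewrite -s2 N2E big_set1.
have NE v : v \in N -> v = g2 \/ v \in N1.
  move=> vN; have [->|vg2] := eqVneq v g2; [by left|right].
  apply: contraT => vN1; have := N_pos v vN.
  suff : x v <= 0 by lra.
  have : \sum_(w in N) x w = l by [].
  rewrite (bigID (mem N1)) /= [X in _ + X](bigD1 v) /=; last by rewrite vN.
  rewrite [X in _ + (_ + X)](bigD1 g2) /=; last first.
    rewrite g2N eq_sym vg2 andbT; apply/negP; rewrite inE inE => /andP[z1g2 _].
    exact: (ladder_disjoint lad z1g2 zg2).
  rewrite (eq_bigl (fun w => w \in N1)); last first.
    by move=> w; rewrite [w \in N1]inE andbCA andbb.
  have : 0 <= \sum_(w | (w \in N) && (w \notin N1) && (w != v) && (w != g2)) x w.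
    by rewrite sumr_ge0.
  by move: s12; rewrite N2E big_set1; lra.
have codeg0 w : w != u -> w != z1 -> w != z2 -> codeg w = 0%N.
  move=> wu w1 w2; have [xw1|//] := other w w1 w2; apply/eqP.
  rewrite cards_eq0; apply/negPn/negP=> /set0Pn[v]; rewrite !inE => /andP[wv uv].
  have vN : v \in N by rewrite inE.
  have wN : w \notin N by apply: contraTN wv => wN; exact: nbhd_indep.
  have w_nbhd t : adj w t -> t \in N.
    move=> wt; apply: contraT => tN.
    have wy1 : w != y1.
      by apply: contraTneq wv => ->; exact: (ladder_top_nbhd lad).
    have wy2 : w != y2.
      by apply: contraTneq wv => ->; exact: (ladder_top_nbhd lad').
    have := ladder_off lad wt wN tN; rewrite !eq_set2.
    by rewrite (negbTE wy1) (negbTE wy2) (negbTE w1) (negbTE w2).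
  have wg2 : adj w g2.
    apply: contraT => nwg2; have := N_pos g2 g2N; have := sub w.
    rewrite xw1 mulr1 -sl [X in _ <= X -> _](_ : _ = \sum_(t in N | adj w t) x t); last first.
      apply: eq_bigl => t; apply/idP/andP => [wt|[]//]; split=> //.
      exact: w_nbhd.
    rewrite [X in X <= _](bigID (adj w)) /= [X in _ + X <= _](bigD1 g2) ?g2N ?nwg2 //=.
    have : 0 <= \sum_(t | (t \in N) && ~~ adj w t && (t != g2)) x t by rewrite sumr_ge0.
    lra.
  have g2_adj : [set u; z2; w] \subset nbhd g2.
    by apply/subsetP=> t; rewrite !inE -orbA => /or3P[]/eqP->; rewrite adj_sym // uN.
  have := nsum_ge g2_adj; rewrite tight // x_g2 setUC big_setU1 /=; last first.
    by rewrite !inE negb_or wu w2.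
  rewrite big_setU1 ?inE //= big_set1 xw1 xu; have := x_le1 y2; lra.
have touch v w : v \in N -> adj v w -> [\/ w = u, w = z1 | w = z2].
  move=> vN vw; have [->|wu] := eqVneq w u; first exact: Or31.
  have [->|w1] := eqVneq w z1; first exact: Or32.
  have [->|w2] := eqVneq w z2; first exact: Or33.
  have /eqP := codeg0 w wu w1 w2; rewrite cards_eq0 => /eqP/setP/(_ v).
  by rewrite in_set0 inE vN inE adj_sym vw.
have g2N1 : g2 \notin N1.
  apply/negP; rewrite inE inE => /andP[z1g2 _].
  exact: (ladder_disjoint lad z1g2 zg2).
have N1_z1 v : v \in N1 -> adj z1 v by rewrite !inE => /andP[].
have N1_N v : v \in N1 -> v \in N by rewrite inE => /andP[].
have nbhd_g2 : nbhd g2 = [set u; z2].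
  apply/setP=> w; rewrite !inE; apply/idP/orP => [gw|[]/eqP->].
  - case: (touch _ _ g2N gw) => e; rewrite e ?eqxx; [by left| |by right].
    by have := ladder_disjoint lad (adjC _) zg2; rewrite -e gw => /(_ isT).
  - by rewrite adj_sym uN.
  - by rewrite adj_sym.
have N1_u v : v \in N1 -> adj v u by move/N1_N/uN/adjC.
have nbhd_N1 v : v \in N1 -> nbhd v = [set u; z1].
  move=> vN1; have vN := N1_N v vN1; apply/setP=> w; rewrite !inE.
  apply/idP/orP => [vw|[]/eqP->]; [|exact: N1_u|exact/adjC/N1_z1].
  case: (touch _ _ vN vw) => e; rewrite e ?eqxx; [by left|by right|].
  by have := ladder_disjoint lad (N1_z1 v vN1) (adjC _); rewrite -e vw => /(_ isT).
have uN' : u \notin N by rewrite inE adj_irrefl.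
have uy1 : u != y1 by apply: contraNneq z1N => e; rewrite inE e.
have uy2 : u != y2 by apply: contraNneq z2N => e; rewrite inE e.
have N_neq v w : v \in N -> w \notin N -> v != w.
  by move=> vN; apply: contraNneq => <-.
(* [N] consists of [g2] and [N1], and all its vertices have degree two. *)
exists #|N1|; split.
  have card_N : #|N| = #|N1|.+1.
    rewrite (_ : N = g2 |: N1) ?cardsU1 ?g2N1 //.
    by apply/setP=> v; apply/idP/setU1P => [/NE//|[->//|/N1_N//]].
  rewrite (card_edges_split nbhd_indep) (ladder_off_card lad).
  rewrite (eq_bigr (fun _ => 2%N)) => [|v /NE[->|vN1]].
  - by rewrite sum_nat_const card_N mulnC mulnS addnAC addnC.
  - by rewrite nbhd_g2 cards2 uz2.
  - by rewrite nbhd_N1 // cards2 uz1.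
apply: (@C7_blowup_intro _ u [:: u; g2; z2; y2; y1; z1]) => //.
- rewrite /= !inE !negb_or uz1 uz2 uy1 uy2 (adj_neq (uN _ g2N)).
  rewrite !(N_neq g2) // [z2 == y2]eq_sym (adj_neq yz2) [z2 == y1]eq_sym yz12.
  by rewrite [z2 == z1]eq_sym z12 [y2 == y1]eq_sym n12 yz21 (adj_neq yz1).
- move=> c cN1; have cN := N1_N c cN1.
  rewrite !inE !negb_or (N_neq c u) // (N_neq c z2) // (N_neq c y2) //.
  rewrite (N_neq c y1) // (N_neq c z1) //= andbT.
  by apply/eqP=> e; rewrite -e cN1 in g2N1.
- move=> a b [[i i5 [-> ->]]|[-> bN1]|[aN1 ->]] /=; last first.
  + exact: N1_u.
  + exact: N1_z1.
  by case: i i5 => [|[|[|[|[|]]]]] //= _; rewrite ?uN // adj_sym.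
- pose s := [:: u; g2; z2; y2; y1; z1].
  have stepN a b : a \in N -> adj a b ->
      blowup_step u s N1 a b \/ blowup_step u s N1 b a.
    move=> aN ab; have [ea|aN1] := NE a aN.
      have : b \in nbhd g2 by rewrite inE -ea.
      rewrite nbhd_g2 !inE ea => /orP[]/eqP->.
        by right; apply: Or31; exists 0%N.
      by left; apply: Or31; exists 1%N.
    have : b \in nbhd a by rewrite inE.
    rewrite nbhd_N1 // in_set2 => /orP[/eqP->|/eqP->].
      by left; apply: Or33; split.
    by right; apply: Or32; split.
  move=> a b ab; have [aN|aN] := boolP (a \in N); first exact: stepN.
  have [bN|bN] := boolP (b \in N); first by apply/or_comm/stepN/adjC.
  have := ladder_off lad ab aN bN; rewrite !eq_set2.
  case/or3P=> /orP[]/andP[/eqP-> /eqP->].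
  + by right; apply: Or31; exists 3%N.
  + by left; apply: Or31; exists 3%N.
  + by left; apply: Or31; exists 4%N.
  + by right; apply: Or31; exists 4%N.
  + by right; apply: Or31; exists 2%N.
  + by left; apply: Or31; exists 2%N.
Qed.

(** Either four edges miss [N] or the two descending paths form a ladder.  In a
    ladder with equality, [x z1 < 1] and [x z2 < 1] would leave one edge from
    each of [z1] and [z2] to [N]; then [l = sigma <= 2], and for [l = 2] the
    tight equations give [x z1 + x z2 = 2], a contradiction. *)
Theorem subharmonic_bound : ~ bipartite G ->
  quartic m l <= 0 /\
  (quartic m l = 0 -> exists k, m = (2 * k + 5)%N /\ C7_blowup G k).
Proof.
move=> nbip.
have [D [i [y1 [y2 [z1 [z2 [g1 [g2 [h1 [h2]]]]]]]]]] := odd_level_edge u no3 no5 nbip.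
case=> Du Dadj [y12 yz1 yz2 zg1 zg2] [gh1 gh2 z12 g12] [lev1 lev2].
have := uniq_ladder_edges (And3 (adj_neq y12) z12 g12) lev1 lev2.
case: lev1 lev2 => [D1 D2 D3 D4] [E1 E2 E3 E4].
set E := [:: _, _ & _] => uE.
have D_off v : (1 < D v)%N -> v \notin N.
  by move=> Dv; apply/negP; rewrite inE => /adjC/Dadj; rewrite Du; lia.
have in_off a b : adj a b -> (1 < D a)%N -> (1 < D b)%N -> [set a; b] \in edges_off N.
  by move=> ab Da Db; rewrite mem_edges_off ab !D_off.
have many (s : seq {set G}) : uniq s -> all [in edges_off N] s -> size s = 4 ->
    quartic m l <= 0 /\
    (quartic m l = 0 -> exists k, m = (2 * k + 5)%N /\ C7_blowup G k).
  move=> us s_off s4.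
  have off4 := card_ge_uniq us s_off; rewrite s4 -(ler_nat R) in off4.
  suff lt0 : quartic m l < 0 by split; [exact: ltW|move=> q0; rewrite q0 ltxx in lt0].
  apply: quartic_lt0 => //; have := mass_identity.
  have : 0 <= \sum_w (codeg w)%:R * (1 - x w).
    by apply: sumr_ge0 => w _; rewrite mulr_ge0 ?subr_ge0.
  have : 0 <= \sum_(v in N) (nsum v - l * x v).
    by apply: sumr_ge0 => v _; rewrite subr_ge0.
  have : l * l <= l * sigma by rewrite ler_wpM2l ?sigma_ge // (le_trans (ler0n _ 2) l_ge2).
  by rewrite -expr2; lra.
have base : [/\ [set y1; y2] \in edges_off N, [set y1; z1] \in edges_off N &
                [set y2; z2] \in edges_off N].
  by split; apply: in_off; rewrite ?D1 ?D2 ?E1 ?E2.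
have [b1 b2 b3] := base.
have [g1N|g1N] := boolP (g1 \in N); last first.
  apply: (many [:: [set y1; y2]; [set y1; z1]; [set y2; z2]; [set z1; g1]]) => //.
    by apply: subseq_uniq uE; rewrite /E /= !eqxx.
  by rewrite /= b1 b2 b3 mem_edges_off zg1 g1N D_off ?D2.
have [g2N|g2N] := boolP (g2 \in N); last first.
  apply: (many [:: [set y1; y2]; [set y1; z1]; [set y2; z2]; [set z2; g2]]) => //.
    by apply: subseq_uniq uE; rewrite /E /= !eqxx; case: ifP => // _; rewrite eqxx.
  by rewrite /= b1 b2 b3 mem_edges_off zg2 g2N D_off ?E2.
set E3' := [set [set y1; y2]; [set y1; z1]; [set y2; z2]].
have [offE|] := eqVneq (edges_off N) E3'; last first.
  have sub3 : E3' \subset edges_off N.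
    by apply/subsetP=> e; rewrite in_setU in_set2 in_set1 -orbA => /or3P[]/eqP->.
  rewrite eqEsubset sub3 andbT => /subsetPn[e eoff].
  rewrite in_setU in_set2 in_set1 !negb_or -andbA.
  case/and3P=> ne1 ne2 ne3.
  apply: (many [:: e; [set y1; y2]; [set y1; z1]; [set y2; z2]]) => //.
    rewrite cons_uniq !inE !negb_or ne1 ne2 ne3 !andTb.
    by apply: subseq_uniq uE; rewrite /E /= !eqxx.
  by rewrite /= eoff b1 b2 b3.
have lad : ladder y1 y2 z1 z2 g1 g2 by [].
have [q_le0 q_eq0] := ladder_quartic lad; split=> // q0.
have [z1_1|/eqP nz1] := eqVneq (x z1) 1; first exact: ladder_extremal lad q0 z1_1.
have [z2_1|/eqP nz2] := eqVneq (x z2) 1; first exact: ladder_extremal (ladder_sym lad) q0 z2_1.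
have [_ /= s12 [e1 e2 e3 e4] [[//|c1] [//|c2] _] _] := q_eq0 q0.
have small w : codeg w = 1%N -> \sum_(v in nbhd w :&: N) x v <= 1.
  by move/eqP/cards1P=> [v ->]; rewrite big_set1.
have := small z1 c1; have := small z2 c2 => le2 le1.
have l2 : l = 2 by apply/eqP; rewrite eq_le l_ge2 andbT; lra.
case: nz1; apply/eqP; rewrite eq_le x_le1 /=.
have := x_le1 z2; rewrite l2 in e1 e2 e3 e4 s12; lra.
Qed.

End Subharmonic.

(** * Labels and isomorphisms *)

Section Relabelling.

Lemma injection_of_labels (A B : finType) (f : A -> nat) (g : B -> nat) :
  (forall i, #|[set a | f a == i]| = #|[set b | g b == i]|) ->
  exists h : A -> B, injective h /\ forall a, g (h a) = f a.
Proof.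
move=> card_fib; pose FA i := enum [set a | f a == i].
pose FB i := enum [set b | g b == i].
have sz i : size (FA i) = size (FB i) by rewrite -!cardE.
have memA a : a \in FA (f a) by rewrite mem_enum inE.
have rankP a : exists b, g b = f a /\ index b (FB (f a)) = index a (FA (f a)).
  have lt_a : (index a (FA (f a)) < size (FB (f a)))%N by rewrite -sz index_mem.
  case def_F: (FB (f a)) lt_a => [|b0 s] //; rewrite -def_F => lt_a.
  exists (nth b0 (FB (f a)) (index a (FA (f a)))).
  rewrite index_uniq // ?enum_uniq //; split=> //.
  by have := mem_nth b0 lt_a; rewrite mem_enum inE => /eqP.
have [h hP] := fin_all_exists rankP.
exists h; split=> [a a' eq_h|a]; last by have [] := hP a.
have [ga ia] := hP a; have [ga' ia'] := hP a'.
have fa : f a = f a' by rewrite -ga -ga' eq_h.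
have mem' : a' \in FA (f a) by rewrite fa.
by rewrite -(nth_index a (memA a)) -ia eq_h fa ia' -fa nth_index.
Qed.

Lemma bijection_of_labels (A B : finType) (f : A -> nat) (g : B -> nat) :
  (forall i, #|[set a | f a == i]| = #|[set b | g b == i]|) ->
  exists h : A -> B, bijective h /\ forall a, g (h a) = f a.
Proof.
move=> card_fib.
have [h [h_inj gh]] := injection_of_labels card_fib.
have [h' [h'_inj _]] := injection_of_labels (fun i => esym (card_fib i)).
by exists h; split=> //; apply: inj_card_bij (leq_card _ h'_inj).
Qed.

Lemma card_label_bij (A B : finType) (h : A -> B) (g : B -> nat) i : bijective h ->
  #|[set a | g (h a) == i]| = #|[set b | g b == i]|.
Proof.
move=> h_bij; rewrite -(card_imset _ (bij_inj h_bij)); apply: eq_card => b.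
have [h' hK h'K] := h_bij; rewrite inE; apply/imsetP/idP.
  by move=> [a]; rewrite inE => ga ->.
by move=> gb; exists (h' b); rewrite ?inE h'K.
Qed.

Lemma succ7_lt7 i j : succ7 i j -> (i < 7)%N /\ (j < 7)%N.
Proof. by case/andP=> i7 /eqP->; rewrite i7 ltn_pmod. Qed.

(** A blow-up without isolated vertices: the label 7 does not occur. *)
Definition C7_labelling (K : sgraph) (k : nat) (lab : K -> nat) :=
  (forall i, #|[set x | lab x == i]| =
     if (i < 6)%N then 1%N else if i == 6 then k else 0%N) /\
  (forall x y, adj x y = succ7 (lab x) (lab y) || succ7 (lab y) (lab x)).

Lemma labelling_of_blowup (K : sgraph) (k : nat) :
  C7_blowup K k -> exists lab : remove_isolated K -> nat, C7_labelling k lab.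
Proof.
move=> [lab [lab8 lab1 lab6 labP]].
have non_isolated x : (lab x < 7)%N = [exists y, adj x y].
  apply/idP/existsP => [lx|[y]]; last first.
    by rewrite labP => /orP[]/succ7_lt7[].
  have nb j : succ7 (lab x) j || succ7 j (lab x) -> (j < 6)%N -> exists y, adj x y.
    move=> lxj j6; have /eqP/cards1P[y] := lab1 j j6; move/setP/(_ y).
    by rewrite !inE eqxx => /eqP lyj; exists y; rewrite labP lyj.
  case: (lab x) lx nb => [|[|[|[|[|[|[|]]]]]]] // _ nb.
  - exact: (nb 1%N).
  - exact: (nb 0%N).
  - exact: (nb 1%N).
  - exact: (nb 2%N).
  - exact: (nb 3%N).
  - exact: (nb 4%N).
  - exact: (nb 0%N).
exists (fun x => lab (val x)); split=> [i|x y]; last exact: labP.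
have [i7|i7] := ltnP i 7; last first.
  have -> : (i < 6)%N = false by lia.
  have -> : (i == 6) = false by lia.
  apply/eqP; rewrite cards_eq0; apply/eqP/setP=> x; rewrite !inE.
  apply/negbTE; have := valP x; rewrite /= -non_isolated; lia.
rewrite -(card_imset _ val_inj).
have -> : [set val x | x in [set x : remove_isolated K | lab (val x) == i]]
    = [set x | lab x == i].
  apply/setP=> y; rewrite inE; apply/imsetP/idP => [[x]|/eqP ly].
    by rewrite inE => lx ->.
  have Py : [pred x : K | [exists y, adj x y]] y by rewrite /= -non_isolated ly.
  by exists (exist _ y Py); rewrite ?inE //= ly.
case: ifP => [|i6]; first exact: lab1.
by rewrite (_ : i = 6) ?eqxx //; lia.
Qed.

Lemma blowup_of_labelling (K : sgraph) (k : nat) (lab : remove_isolated K -> nat) :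
  C7_labelling k lab -> C7_blowup K k.
Proof.
move=> [card_lab labP].
pose lab' (x : K) : nat := if insub x is Some x' then lab x' else 7.
have lab'_val x : lab' (val x) = lab x by rewrite /lab' valK.
have lab7 x : (lab x < 7)%N.
  rewrite ltnNge; apply/negP=> l7; have := card_lab (lab x).
  have -> : (lab x < 6)%N = false by lia.
  have -> : (lab x == 6) = false by lia.
  by move/eqP; rewrite cards_eq0 => /eqP/setP/(_ x); rewrite !inE eqxx.
have card_lab' i : (i < 7)%N -> #|[set x | lab' x == i]| = #|[set x | lab x == i]|.
  move=> i7; rewrite -(card_imset [set x | lab x == i] val_inj).
  apply: eq_card => x; rewrite inE; apply/idP/imsetP => [|[x']]; last first.
    by rewrite inE => lx ->; rewrite lab'_val.
  rewrite /lab'; case: insubP => [x' _ <- lx|_ /eqP i7']; last by rewrite -i7' in i7.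
  by exists x' => //; rewrite inE.
exists lab'; split.
- by move=> x; rewrite /lab'; case: insub => // x'; exact: leq_trans (lab7 x') _.
- by move=> i i6; rewrite card_lab' ?card_lab ?i6 //; lia.
- by rewrite card_lab' ?card_lab.
have isolated x : ~~ [exists z, adj x z] -> lab' x = 7 /\ forall y, adj x y = false.
  move=> nPx; split; first by rewrite /lab' insubN.
  by move=> y; move/existsPn/(_ y)/negbTE: nPx.
have no_succ7 i : succ7 i 7 = false.
  by rewrite /succ7 eq_sym ltn_eqF ?andbF // ltn_pmod.
move=> x y; have [Px|/isolated[-> ->]] := boolP [exists z, adj x z]; last first.
  by rewrite no_succ7.
have [Py|/isolated[-> adjy]] := boolP [exists z, adj y z]; last first.
  by rewrite no_succ7 adj_sym adjy.
pose sub := exist (fun x : K => [pred x : K | [exists y, adj x y]] x).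
by have := labP (sub x Px) (sub y Py); rewrite -!lab'_val.
Qed.

Lemma iso_of_blowups (G H : sgraph) (k : nat) :
  C7_blowup G k -> C7_blowup H k -> iso_up_to_isolated G H.
Proof.
move=> /labelling_of_blowup[labG [cardG adjG]].
move=> /labelling_of_blowup[labH [cardH adjH]].
have [h [h_bij labh]] :=
  bijection_of_labels (fun i => etrans (cardG i) (esym (cardH i))).
by exists h; split=> // x y; rewrite adjH adjG !labh.
Qed.

Lemma blowup_of_iso (G H : sgraph) (k : nat) :
  iso_up_to_isolated G H -> C7_blowup H k -> C7_blowup G k.
Proof.
move=> [f [f_bij f_adj]] /labelling_of_blowup[lab [card_lab labP]].
apply: (@blowup_of_labelling _ _ (fun x => lab (f x))); split=> [i|x y].
  by rewrite (card_label_bij _ _ f_bij).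
by rewrite -f_adj labP.
Qed.

Lemma subdivide3_sym (G : sgraph) (u v : G) :
  exists f : subdivide3 u v -> subdivide3 v u,
    bijective f /\ forall x y, adj (f x) (f y) = adj x y.
Proof.
pose f (x : G + 'I_3) := match x with inl a => inl a | inr i => inr (rev_ord i) end.
have fK : involutive f by case=> //= i; rewrite rev_ordK.
exists f; split; first exact: inv_bij.
have set_uv : [set u; v] = [set v; u] by rewrite setUC.
case=> [a|i] [b|j]; rewrite /= /sub3_rel /= ?set_uv //.
- by case: j => [[|[|[|//]]] ?]; rewrite /= ?andbF ?andbT ?orbF.
- by case: i => [[|[|[|//]]] ?]; rewrite /= ?andbF ?andbT ?orbF.
- by case: i => [[|[|[|//]]] ?]; case: j => [[|[|[|//]]] ?].
Qed.

Lemma blowup_bij (G H : sgraph) (k : nat) (f : G -> H) : bijective f ->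
  (forall x y, adj (f x) (f y) = adj x y) -> C7_blowup H k -> C7_blowup G k.
Proof.
move=> f_bij f_adj [lab [lab8 lab1 lab6 labP]]; exists (fun x => lab (f x)).
split=> // [i i6||x y]; rewrite ?(card_label_bij _ _ f_bij) //; first exact: lab1.
by rewrite -labP f_adj.
Qed.

(** The six labels of multiplicity one go along the path of length 5 from the
    vertex of the part of size 2 off the subdivided edge to the one on it: it
    consists of an edge to the other end of the subdivided edge, followed by the
    path that replaces this edge. *)
Lemma subdivide3_blowup t (u v : complete_bipartite 2 t) :
  adj u v -> C7_blowup (subdivide3 u v) t.-1.
Proof.
(* Reversing the new path exchanges the two orientations of the edge. *)
wlog [[i ->] [j ->]] : u v / (exists i, u = inl i) /\ (exists j, v = inr j).
  move=> IH; case: u v => [i|j] [i'|j'] // _.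
    by apply: IH => //; split; [exists i|exists j'].
  have [f [f_bij f_adj]] := subdivide3_sym (inr j : complete_bipartite 2 t) (inl i').
  by apply: (blowup_bij f_bij f_adj); apply: IH => //; split; [exists i'|exists j].
move=> _; set K := subdivide3 _ _.
pose i' := rev_ord i.
have succ3 (k k' : 'I_3) : k' = k.+1 :> nat ->
    (k = 0%N :> nat /\ k' = 1%N :> nat) \/ (k = 1%N :> nat /\ k' = 2%N :> nat).
  by case: k k' => [[|[|[|//]]] ?] [[|[|[|//]]] ?] //=; [left|right].
have rev2 (a b : 'I_2) : (b != a) = (b == rev_ord a).
  by case: a b => [[|[|//]] ?] [[|[|//]] ?].
have i'P b : (b != i) = (b == i') by exact: rev2.
pose o k : 'I_3 := inord k.
have oE (k : 'I_3) n : (n < 3)%N -> k = n :> nat -> k = o n.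
  by move=> n3 kn; apply: val_inj; rewrite /= inordK.
pose s : seq K := [:: inl (inl i'); inl (inr j); inr (o 2); inr (o 1); inr (o 0);
                      inl (inl i)].
pose C : {set K} := [set inl (inr j') | j' in [set j' | j' != j]].
have card_C : #|C| = t.-1.
  rewrite card_imset => [|a b []//]; have := cardC1 j; rewrite card_ord => <-.
  by apply: eq_card => a; rewrite !inE.
have C_inr (b : 'I_t) : b != j -> (inl (inr b) : K) \in C.
  by move=> bj; apply/imsetP; exists b; rewrite ?inE.
have ii' : i' != i by rewrite i'P.
rewrite -card_C; apply: (@C7_blowup_intro K (inl (inl i)) s C) => //.
- have o_neq m n : (m < 3)%N -> (n < 3)%N -> m != n -> o m != o n.
    by move=> m3 n3; rewrite -val_eqE /= !inordK.
  rewrite /= !inE /= !negb_or.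
  by apply/and3P; split; [exact: ii'|rewrite !andbT; apply/andP; split; exact: o_neq|
    rewrite !andbT; exact: o_neq].
- move=> c /imsetP[b]; rewrite inE => bj ->; rewrite !inE /= orbF; exact: bj.
- have edge (a : 'I_2) (b : 'I_t) : (a != i) || (b != j) ->
      adj (inl (inl a) : K) (inl (inr b)).
    by move=> ab; rewrite /= /sub3_rel /= eq_set2 orbF negb_and; apply/orP; left.
  move=> x y [[n n5 [-> ->]]|[-> /imsetP[b]]|[/imsetP[b]]]; last first.
  + rewrite inE => bj -> ->; rewrite adj_sym; apply: edge; by rewrite bj orbT.
  + rewrite inE => bj ->; apply: edge; by rewrite bj orbT.
  case: n n5 => [|[|[|[|[|]]]]] //= _.
  + by apply: edge; rewrite ii'.
  + by rewrite /sub3_rel /= !inordK // eqxx.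
  + by rewrite /sub3_rel /= !inordK.
  + by rewrite /sub3_rel /= !inordK.
  + by rewrite /sub3_rel /= !inordK // eqxx.
have half x y : sub3_half (inl i : complete_bipartite 2 t) (inr j) x y ->
    @blowup_step K (inl (inl i)) s C x y \/ @blowup_step K (inl (inl i)) s C y x.
  have half_lr (a : 'I_2) (b : 'I_t) : (a != i) || (b != j) ->
      @blowup_step K (inl (inl i)) s C (inl (inl a)) (inl (inr b)) \/
      @blowup_step K (inl (inl i)) s C (inl (inr b)) (inl (inl a)).
    have [->|] /= := eqVneq a i.
      by move=> bj; left; apply: Or32; split; last exact: C_inr.
    rewrite i'P => /eqP-> _; have [->|bj] := eqVneq b j.
      by left; apply: Or31; exists 0%N.
    by right; apply: Or33; split; first exact: C_inr.
  case: x y => [[a|b]|k] [[a'|b']|k'] //=.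
  + by rewrite eq_set2 orbF negb_and; exact: half_lr.
  + rewrite orbF => /andP[/eqP[->] /eqP k0]; right; apply: Or31; exists 4%N => //.
    by rewrite /= (oE _ _ _ k0).
  + by rewrite eq_set2 negb_or !negb_and /= orbC => /half_lr[]; [right|left].
  + case/andP=> /eqP[->] /eqP k2; left; apply: Or31; exists 1%N => //.
    by rewrite /= (oE _ _ _ k2).
  + move/eqP/succ3=> [[k0 k1]|[k1 k2]]; right; apply: Or31.
      by exists 3%N => //; rewrite /= (oE k 0%N) // (oE k' 1%N).
    by exists 2%N => //; rewrite /= (oE k 1%N) // (oE k' 2%N).
move=> x y; rewrite /= /sub3_rel => /orP[/half//|/half/or_comm//].
Qed.

End Relabelling.

(** * Eigenvalues *)

Section Eigenfunctions.
Variables (R : realType) (G : sgraph).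

Lemma eigenfunctionP (a : R) :
  reflect (exists2 z : G -> R, exists v, z v != 0 &
             forall v, \sum_(w | adj v w) z w = a * z v)
          (eigenvalue (adjacency_matrix R G) a).
Proof.
have sumE (z : G -> R) v : \sum_(w | adj v w) z w
    = \sum_(i < #|G|) z (enum_val i) * adjacency_matrix R G i (enum_rank v).
  rewrite (reindex (@enum_val G G)) /=; last first.
    by apply: onW_bij; exact: enum_val_bij.
  rewrite big_mkcond; apply: eq_bigr => i _.
  by rewrite mxE enum_rankK adj_sym; case: adj; rewrite ?mulr1 ?mulr0.
apply: (iffP eigenvalueP) => [[z zA z_neq0]|[z [v zv] zA]].
  exists (fun v => z 0 (enum_rank v)).
    have [i zi] : exists i, z 0 i != 0 by apply/rV0Pn.
    by exists (enum_val i); rewrite enum_valK.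
  move=> v; rewrite sumE; move/matrixP/(_ 0 (enum_rank v)): zA.
  by rewrite !mxE => <-; apply: eq_bigr => i _; rewrite enum_valK.
exists (\row_i z (enum_val i)).
  apply/rowP=> i; rewrite !mxE -zA sumE enum_valK.
  by apply: eq_bigr => j _; rewrite mxE.
by apply/rV0Pn; exists (enum_rank v); rewrite mxE enum_rankK.
Qed.

Lemma eigenvalue_quartic (a : R) :
  no_closed_3walk G -> no_closed_5walk G -> ~ bipartite G ->
  eigenvalue (adjacency_matrix R G) a -> 2 <= `|a| ->
  let m := #|edge_set G| in
  quartic m `|a| <= 0 /\
  (quartic m `|a| = 0 -> exists k, m = (2 * k + 5)%N /\ C7_blowup G k).
Proof.
move=> no3 no5 nbip /eigenfunctionP[z [v0 zv0] zA] a2.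
have [u _ zmax] := @arg_maxP _ _ _ v0 xpredT (fun v => `|z v|) isT.
have zu : 0 < `|z u| by apply: lt_le_trans (zmax v0 isT); rewrite normr_gt0.
apply: (@subharmonic_bound R G (fun v => `|z v| / `|z u|) `|a| u) => //.
- by move=> v; rewrite divr_ge0.
- by move=> v; rewrite ler_pdivrMr // mul1r; exact: zmax.
- by rewrite divff // gt_eqF.
- move=> v; rewrite -mulr_suml mulrA -normrM -zA ler_wpM2r ?invr_ge0 //.
  exact: ler_norm_sum.
Qed.

Lemma sum_labels (lab : G -> nat) (F : nat -> R) : (forall x, (lab x < 8)%N) ->
  \sum_x F (lab x) = \sum_(0 <= i < 8) #|[set x | lab x == i]|%:R * F i.
Proof.
move=> lab8; rewrite big_mkord (partition_big (fun x => inord (lab x) : 'I_8) xpredT) //=.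
apply: eq_bigr => i _.
rewrite (eq_bigl (fun x => x \in [set x | lab x == i])); last first.
  by move=> x; rewrite inE -val_eqE /= inordK ?lab8.
rewrite (eq_bigr (fun _ => F i)) => [|x]; last by rewrite inE => /eqP->.
by rewrite sumr_const mulr_natl.
Qed.

(** The eigenvector is symmetric under the reflection of the 7-cycle that fixes
    label 6.  With value 1 at the two neighbours (labels 0 and 5) of that class,
    the equations at labels 6, 2 and 1 determine the other values, and the
    equation at label 0 is the vanishing of the quartic. *)
Lemma blowup_eigenvalue (k : nat) (l : R) : C7_blowup G k -> 2 <= l ->
  quartic (2 * k + 5) l = 0 -> eigenvalue (adjacency_matrix R G) l.
Proof.
move=> [lab [lab8 lab1 lab6 labP]] l2 q0.
have k1 := kappa_ge1 l2.
pose r := (l ^+ 2 - l - 1)^-1.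
have rE : (l ^+ 2 - l - 1) * r = 1 by rewrite mulfV // gt_eqF //; lra.
have kE : 2 * k%:R = l ^+ 2 - 1 - r.
  have : (l ^+ 2 - 1 - 2 * k%:R) * (l ^+ 2 - l - 1) = 1.
    by move: q0; rewrite /quartic natrD natrM => q0; lra.
  move/(congr1 (fun t => t * r)); rewrite -mulrA rE mulr1 mul1r; lra.
have l0 : l != 0 by rewrite gt_eqF //; lra.
pose F (i : nat) : R := nth 0 [:: 1 : R; (l - 1) * r; r; r; (l - 1) * r; 1; 2 / l] i.
apply/eigenfunctionP; exists (fun x => F (lab x)).
  have /eqP/cards1P[v] := lab1 0%N isT; move/setP/(_ v).
  by rewrite !inE eqxx => /eqP lv; exists v; rewrite lv /F /= oner_neq0.
move=> v; rewrite big_mkcond /=.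
under eq_bigr do rewrite labP.
rewrite (sum_labels (fun j => if succ7 (lab v) j || succ7 j (lab v) then F j else 0)) //.
rewrite unlock /= lab6 !(lab1 0%N, lab1 1%N, lab1 2%N, lab1 3%N, lab1 4%N, lab1 5%N) //.
rewrite !mul1r addr0.
have hub : k%:R * (2 / l) = l - (l - 1) * r.
  apply: (mulIf l0); rewrite mulrA divfK // mulrC kE; lra.
have common : l * (2 / l) = 2 by rewrite mulrC divfK.
move: (lab8 v); case: (lab v) => [|[|[|[|[|[|[|[|]]]]]]]] // _.
all: rewrite /F /= /succ7 /= ?addr0 ?add0r ?mulr0 ?addr0 ?add0r //; lra.
Qed.

End Eigenfunctions.

Section SpectralRadius.
Variables (R : realType) (G : sgraph).
Local Notation A := (adjacency_matrix R G).

Lemma max_norm_seq (s : seq R) : s != [::] ->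
  exists2 a, a \in s & forall b, b \in s -> `|b| <= `|a|.
Proof.
elim: s => // b [|c s] IHs _.
  by exists b; rewrite ?inE // => b'; rewrite inE => /eqP->.
have [//|a a_s maxa] := IHs _.
have [le_ba|lt_ab] := leP `|b| `|a|.
  exists a; first by rewrite in_cons a_s orbT.
  by move=> d; rewrite in_cons => /orP[/eqP->|/maxa].
exists b; first by rewrite in_cons eqxx.
move=> d; rewrite in_cons => /orP[/eqP->//|/maxa/le_trans]; apply.
exact: ltW.
Qed.

(** The eigenvalues are the finitely many roots of the characteristic
    polynomial, so the supremum is attained unless there are none. *)
Lemma spectral_radiusP :
  (forall a, eigenvalue A a -> `|a| <= spectral_radius R G) /\
  (spectral_radius R G = 0 \/
   exists2 a, eigenvalue A a & `|a| = spectral_radius R G).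
Proof.
set rs := polyrcf.rootsR (char_poly A).
have rsP a : eigenvalue A a = (a \in rs).
  have := polyrcf.roots_on_rootsR (monic_neq0 (char_poly_monic A)) a.
  by rewrite in_itv /= eigenvalue_root_char.
have [rs0|rs_neq0] := eqVneq rs [::].
  have noeig a : ~~ eigenvalue A a by rewrite rsP rs0.
  split=> [a ea|]; first by have := noeig a; rewrite ea.
  left; apply: sup_out => -[[x [a ea _]] _].
  by have := noeig a; rewrite ea.
have [a a_rs maxa] := max_norm_seq rs_neq0.
have ub_a : ubound [set `|b| | b in [set b : R | eigenvalue A b]]%classic `|a|.
  by move=> x [b eb <-]; apply: maxa; rewrite -rsP.
have mem_a : [set `|b| | b in [set b : R | eigenvalue A b]]%classic `|a|.
  by exists a => //; rewrite /= rsP.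
have le_sup : forall b, eigenvalue A b -> `|b| <= spectral_radius R G.
  by move=> b eb; apply: ub_le_sup; [exists (`|a|) | exists b].
split=> //; right; exists a; first by rewrite rsP.
apply/eqP; rewrite eq_le le_sup ?rsP //=.
by apply: ge_sup => //; exists `|a|.
Qed.

End SpectralRadius.

(** * The polynomial [L] and its largest root *)

Section Gamma.
Variables (R : realType) (m : nat).

(** The cubic factor is the minimal polynomial of [2 cos (2 pi / 7)], so all
    its roots are below 2. *)
Lemma horner_L (x : R) :
  (L R m).[x] = (x ^+ 3 + x ^+ 2 - 2 * x - 1) * quartic m x.
Proof.
rewrite /L /quartic !(hornerD, hornerN, hornerZ, hornerXn, hornerX, hornerC).
by ring.
Qed.

Lemma cubic_gt0 (x : R) : 2 <= x -> 0 < x ^+ 3 + x ^+ 2 - 2 * x - 1.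
Proof.
move=> x2; have -> : x ^+ 3 + x ^+ 2 - 2 * x - 1
    = (x - 2) * (x ^+ 2 + 3 * x + 4) + 7 by ring.
apply: ltr_wpDl; last by lra.
apply: mulr_ge0; first by lra.
by have : 0 <= x ^+ 2 by [exact: sqr_ge0]; lra.
Qed.

Lemma quartic_gt0 (x : R) : m%:R + 2 <= x -> 0 < quartic m x.
Proof.
move=> xm; have m0 : 0 <= m%:R :> R by [].
have : 1 <= (x ^+ 2 + 4 - m%:R) * (x ^+ 2 - x - 1) - 1.
  have -> : (x ^+ 2 + 4 - m%:R) * (x ^+ 2 - x - 1) - 1 =
    (x * (x - 1) + (x - m%:R) + 4) * ((x - 2) * (x + 1) + 1) - 1 by ring.
  have h1 : 0 <= x * (x - 1) by apply: mulr_ge0; lra.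
  have h2 : 0 <= (x - 2) * (x + 1) by apply: mulr_ge0; lra.
  have : 1 * 4 <= ((x - 2) * (x + 1) + 1) * (x * (x - 1) + (x - m%:R) + 4).
    by apply: ler_pM; lra.
  lra.
by rewrite /quartic; lra.
Qed.

Lemma L_roots_le (x : R) : root (L R m) x -> x <= m%:R + 2.
Proof.
move=> /rootP Lx; rewrite leNgt; apply/negP=> lt_x.
have m0 : 0 <= m%:R :> R by [].
have : 0 < (L R m).[x].
  by rewrite horner_L mulr_gt0 ?cubic_gt0 ?quartic_gt0 //; lra.
by rewrite Lx ltxx.
Qed.

Lemma root_le_gamma (x : R) : root (L R m) x -> x <= gamma R m.
Proof.
move=> Lx; apply: ub_le_sup => //.
by exists (m%:R + 2) => y; exact: L_roots_le.
Qed.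

(** [L] changes sign between [x] and [x + m + 2]. *)
Lemma root_above (x : R) : 2 <= x -> quartic m x <= 0 ->
  exists2 y, root (L R m) y & x <= y.
Proof.
move=> x2 qx; have m0 : 0 <= m%:R :> R by [].
pose b := x + m%:R + 2.
have xb : x <= b by rewrite /b; lra.
have Lx : (L R m).[x] <= 0.
  by rewrite horner_L mulr_ge0_le0 // ltW // cubic_gt0.
have Lb : 0 <= (L R m).[b].
  by rewrite horner_L mulr_ge0 ?ltW ?cubic_gt0 ?quartic_gt0 // /b; lra.
have [|y /andP[xy _] Ly] := poly_ivt xb (p := L R m); first by rewrite Lx Lb.
by exists y.
Qed.

Lemma le_gamma (x : R) : 2 <= x -> quartic m x <= 0 -> x <= gamma R m.
Proof.
move=> x2 qx; have [y Ly xy] := root_above x2 qx.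
exact: le_trans xy (root_le_gamma Ly).
Qed.

Lemma lt_gamma (x : R) : 2 <= x -> quartic m x < 0 -> x < gamma R m.
Proof.
move=> x2 qx; have [y Ly xy] := root_above x2 (ltW qx).
apply: lt_le_trans (root_le_gamma Ly); rewrite lt_neqAle xy andbT.
apply: contraTneq Ly => <-; rewrite rootE horner_L mulf_neq0 //.
  by rewrite gt_eqF // cubic_gt0.
by rewrite lt_eqF.
Qed.

Lemma gamma_ge2 : (7 <= m)%N -> 2 <= gamma R m.
Proof.
move=> m7; apply: le_gamma => //; rewrite /quartic.
have : 7 <= m%:R :> R by rewrite ler_nat.
lra.
Qed.

(** Roots below 2 do not matter, because there is also one that is at least
    2. *)
Lemma gamma_le (c : R) : (7 <= m)%N ->
  (forall x, 2 <= x -> quartic m x = 0 -> x <= c) -> gamma R m <= c.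
Proof.
move=> m7 bound.
have bound' x : 2 <= x -> root (L R m) x -> x <= c.
  move=> x2 /rootP; rewrite horner_L => /eqP; rewrite mulf_eq0.
  by rewrite gt_eqF ?cubic_gt0 //= => /eqP; exact: bound.
have [|y Ly y2] := @root_above 2 (lexx _).
  have : 7 <= m%:R :> R by rewrite ler_nat.
  by rewrite /quartic; lra.
apply: ge_sup => [|x /= Lx]; first by exists y.
have [x2|/ltW x2] := leP 2 x; first exact: bound'.
exact: le_trans x2 (le_trans y2 (bound' y y2 Ly)).
Qed.

End Gamma.

(** * The spectral bound *)

Lemma card_edges_ge7 (G : sgraph) :
  no_closed_3walk G -> no_closed_5walk G -> ~ bipartite G ->
  (7 <= #|edge_set G|)%N.
Proof.
move=> no3 no5 nbip.
have [u _|G0] := pickP (@predT G); last first.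
  by case: nbip; exists xpredT => x; have := G0 x.
have [D [i [y1 [y2 [z1 [z2 [g1 [g2 [h1 [h2]]]]]]]]]] := odd_level_edge u no3 no5 nbip.
case=> _ _ [y12 yz1 yz2 zg1 zg2] [gh1 gh2 z12 g12] [lev1 lev2].
have n12 : y1 != y2 by apply: contraTneq y12 => ->; rewrite adj_irrefl.
have uE := uniq_ladder_edges (And3 n12 z12 g12) lev1 lev2.
apply: (card_ge_uniq uE).
by rewrite /= !mem_edge y12 yz1 yz2 zg1 zg2 gh1 gh2.
Qed.

Theorem theorem3p2 (R : realType) (G : sgraph) (m : nat)
    (card_edges : #|edge_set G| = m)
    (C3_free : ~ contains G (cycle_graph 3))
    (C5_free : ~ contains G (cycle_graph 5))
    (nonbipartite : ~ bipartite G) :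
  spectral_radius R G <= gamma R m /\
  (spectral_radius R G = gamma R m <->
   odd m /\
   exists u v : complete_bipartite 2 ((m - 3) %/ 2),
     adj u v /\ iso_up_to_isolated G (subdivide3 u v)).
Proof.
have no3 := C3_free_walk C3_free; have no5 := C5_free_walk no3 C5_free.
have m7 : (7 <= m)%N by rewrite -card_edges card_edges_ge7.
have g2 := gamma_ge2 R m7.
have [eig_le attained] := spectral_radiusP R G.
have le_radius : spectral_radius R G <= gamma R m.
  case: attained => [->|[a ea <-]]; first by lra.
  have [a2|/ltW a2] := leP 2 `|a|; last exact: le_trans a2 g2.
  apply: le_gamma => //; rewrite -card_edges.
  by have [] := eigenvalue_quartic no3 no5 nonbipartite ea a2.
split=> //; split=> [radius_eq|[m_odd [u [v [uv iso_G]]]]].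
  case: attained => [radius0|[a ea norm_a]].
    by rewrite -radius_eq radius0 lern0 in g2.
  have a_gamma : `|a| = gamma R m by rewrite norm_a.
  have a2 : 2 <= `|a| by rewrite a_gamma.
  have [q_le0 q_eq0] := eigenvalue_quartic no3 no5 nonbipartite ea a2.
  rewrite card_edges in q_le0 q_eq0.
  have q0 : quartic m `|a| = 0.
    apply/eqP; rewrite eq_le q_le0 leNgt; apply/negP=> /(lt_gamma a2).
    by rewrite a_gamma ltxx.
  have [k [mk blowG]] := q_eq0 q0; split; first by rewrite mk; lia.
  have -> : ((m - 3) %/ 2)%N = k.+1 by lia.
  exists (inl ord0), (inr ord0); split=> //.
  exact: iso_of_blowups blowG (@subdivide3_blowup k.+1 (inl ord0) (inr ord0) isT).
apply/eqP; rewrite eq_le le_radius /=; apply: gamma_le => // x x2 qx.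
have blowG := blowup_of_iso iso_G (subdivide3_blowup uv).
have := @blowup_eigenvalue R G _ x blowG x2.
have -> : (2 * ((m - 3) %/ 2).-1 + 5)%N = m by lia.
move=> /(_ qx)/eig_le; apply: le_trans; exact: ler_norm.
Qed.
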